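(* Let $l$ be a positive integer and let $P$ be an $l$-reflexive loop. Then the sum of the length of $P$ and the length of the dual $l$-reflexive loop $lP^*$ equals $12\,w(P)$, where $w(P)\in\mathbb{Z}$ is the winding number of $P$.
   Context: Let $N=\mathbb{Z}^2$ and let $M=\mathrm{Hom}(N,\mathbb{Z})$, identified with $\mathbb{Z}^2$ via the dual basis. A nonzero lattice point $x$ is primitive if the segment from $\mathbf{0}$ to $x$ contains no lattice points other than its endpoints. $l$-reflexive loop: let $x_1,\dots,x_t\in N$ be nonzero lattice points and put $x_0:=x_t$, $x_{t+1}:=x_1$. They are the boundary lattice points of an $l$-reflexive loop $P$ if for each $i=1,\dots,t$: (1) $x_{i+1}-x_i$ is primitive; (2) the determinant of the $2\times2$ matrix $A_i$ formed by $x_i,x_{i+1}$ equals $\pm l$; (3) if $x_i$ is a vertex (i.e. $x_i\notin\mathrm{conv}\{x_{i-1},x_{i+1}\}$) then $x_i$ is primitive. The loop may be a non-convex or self-intersecting polygonal loop. The length of $P$ is $\sum_{i=1}^t\det(A_i)/l$. Dual loop: for each $i$ let $u_i\in M$ be the primitive outer normal to the segment $\mathrm{conv}\{x_i,x_{i+1}\}$, i.e. the unique primitive $u_i$ with $\langle u_i,x_i\rangle=\langle u_i,x_{i+1}\rangle=l$. The dual $l$-reflexive loop $lP^*$ is the loop in $M$ whose boundary lattice points are the points of $\bigcup_{i=1}^t\mathrm{conv}\{u_i,u_{i+1}\}\cap M$ (indices cyclic), traversed successively from $u_i$ to $u_{i+1}$, immediate repetitions omitted. The winding number $w(P)$ is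 the winding number around the origin (counterclockwise positive) of the closed polygonal curve $x_1\to x_2\to\cdots\to x_t\to x_1$. *)

(* Defs.v *)
From HB Require Import structures.
From mathcomp Require Import all_boot all_order all_algebra.
From mathcomp Require Import all_classical all_reals all_analysis.
From mathcomp Require Import ring lra zify.

Set Implicit Arguments.
Unset Strict Implicit.
Unset Printing Implicit Defensive.

Import Order.TTheory GRing.Theory Num.Theory.
Import numFieldNormedType.Exports.

Local Open Scope classical_set_scope.
Local Open Scope ring_scope.

(* Both N = Z^2 and its dual M (in the dual basis) are 'rV[int]_2. *)

Definition pairing (u x : 'rV[int]_2) : int := (u *m x^T) 0 0.

Definition det2 (x y : 'rV[int]_2) : int := \det (col_mx x y : 'M[int]_2).

Definition toR (R : realType) (x : 'rV[int]_2) : 'rV[R]_2 := map_mx intr x.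

Definition segment (R : realType) (a b : 'rV[R]_2) : set 'rV[R]_2 :=
  [set (1 - t) *: a + t *: b | t in `[0, 1]].

(* conv {a, b} \cap Z^2 *)
Definition lattice_conv (R : realType) (a b : 'rV[int]_2) : set 'rV[int]_2 :=
  [set y | segment (toR R a) (toR R b) (toR R y)].

Definition primitive (R : realType) (x : 'rV[int]_2) : Prop :=
  x != 0 /\ lattice_conv R 0 x `<=` [set 0; x].

(* A loop is the sequence x_1, ..., x_t of its boundary lattice points;
   [pt P] is the t-periodic extension, [pt P 0] being x_1. *)
Definition pt (P : seq 'rV[int]_2) (i : nat) : 'rV[int]_2 :=
  nth 0 P (i %% size P)%N.

(* As [pt P] is periodic, the vertex condition at x_i is stated with the
   indices shifted by one. *)
Definition reflexive_loop (R : realType) (l : nat) (P : seq 'rV[int]_2) : Prop :=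
  (0 < size P)%N /\
  forall i : nat,
    [/\ pt P i != 0,
        primitive R (pt P i.+1 - pt P i),
        det2 (pt P i) (pt P i.+1) = l%:Z \/ det2 (pt P i) (pt P i.+1) = - l%:Z
      & ~ lattice_conv R (pt P i) (pt P i.+2) (pt P i.+1) ->
        primitive R (pt P i.+1)].

Definition loop_length (l : nat) (P : seq 'rV[int]_2) : rat :=
  \sum_(i < size P) (det2 (pt P i) (pt P i.+1))%:~R / l%:R.

Definition is_outer_normal (R : realType) (l : nat) (x y u : 'rV[int]_2) : Prop :=
  [/\ primitive R u, pairing u x = l%:Z & pairing u y = l%:Z].

(* "The" u with [is_outer_normal R l x y u]; see [outer_normalP] below for
   existence and [outer_normal_unique] for uniqueness. *)
Definition outer_normal (R : realType) (l : nat) (x y : 'rV[int]_2) : 'rV[int]_2 :=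
  xget 0 [set u | is_outer_normal R l x y u].

(* The lattice points of conv {u, v}, listed from u to v (both included): the
   gcd g of the coordinates of v - u is the lattice length of the segment, and
   consecutive points differ by (v - u) / g.  See [segment_pointsP]. *)
Definition segment_points (u v : 'rV[int]_2) : seq 'rV[int]_2 :=
  let d := v - u in
  let g := gcdn `|d 0 0| `|d 0 1| in
  [seq \row_k (u 0 k + j%:Z * divz (d 0 k) g) | j <- iota 0 g.+1].

Fixpoint drop_repeats (T : eqType) (x : T) (s : seq T) : seq T :=
  if s is y :: s' then
    if y == x then drop_repeats x s' else y :: drop_repeats y s'
  else [::].

(* Omits every entry equal to its cyclic predecessor; a constant sequence
   becomes a single point. *)
Definition drop_cyclic_repeats (T : eqType) (s : seq T) : seq T :=
  if s is x :: s' then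
    if constant s then [:: x] else drop_repeats (last x s') s
  else [::].

Definition dual_loop (R : realType) (l : nat) (P : seq 'rV[int]_2) :
    seq 'rV[int]_2 :=
  let u i := outer_normal R l (pt P i) (pt P i.+1) in
  drop_cyclic_repeats
    (flatten [seq segment_points (u i) (u i.+1) | i <- iota 0 (size P)]).

(* The closed polygonal curve through pt P 0, pt P 1, ..., pt P (size P) = pt P 0,
   parametrized on [0, size P] with unit time for each edge. *)
Definition polygonal_curve (R : realType) (P : seq 'rV[int]_2) (s : R) :
    'rV[R]_2 :=
  let i := Num.truncn s in
  (1 - (s - i%:R)) *: toR R (pt P i) + (s - i%:R) *: toR R (pt P i.+1).

(* w is the number of counterclockwise turns around the origin made by the curve
   gamma on [0, T]: gamma has a continuous argument theta there, which
   increases by 2 pi w. *)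
Definition is_winding_number (R : realType) (T : R) (gamma : R -> 'rV[R]_2)
    (w : int) : Prop :=
  exists theta : R -> R,
    [/\ {within `[0, T], continuous theta},
        (forall s, s \in `[0, T] -> exists2 r : R, 0 < r &
           gamma s = \row_k (if k == 0 then r * cos (theta s)
                             else r * sin (theta s)))
      & theta T - theta 0 = 2 * pi * w%:~R].

(* A closed curve avoiding the origin has exactly one winding number; the edges
   of a reflexive loop avoid the origin as their endpoints are independent. *)
Definition winding_number (R : realType) (P : seq 'rV[int]_2) : int :=
  xget 0 [set w | is_winding_number (size P)%:R (@polygonal_curve R P) w].

Lemma lattice_convP (R : realType) (u v y : 'rV[int]_2) :
  lattice_conv R u v y <->
  exists2 t : R, 0 <= t <= 1 &
    forall k, (y 0 k - u 0 k)%:~R = t * (v 0 k - u 0 k)%:~R.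
Proof.
split=> [[t /= + /rowP tE]|[t t01 tE]].
  rewrite in_itv /= => t01; exists t => // k.
  have := tE k; rewrite !mxE !rmorphB /= => <-; ring.
exists t; first by rewrite /= in_itv.
apply/rowP => k; have := tE k; rewrite !mxE !rmorphB /= => H.
transitivity ((u 0 k)%:~R + t * ((v 0 k)%:~R - (u 0 k)%:~R)); first by ring.
by rewrite -H; ring.
Qed.

Lemma rV2P (x y : 'rV[int]_2) : x 0 0 = y 0 0 -> x 0 1 = y 0 1 -> x = y.
Proof.
move=> e0 e1; apply/rowP => k; case: (unliftP 0 k) => [j ->|-> //].
by rewrite (ord1 j) (_ : lift 0 0 = 1) //; exact/val_inj.
Qed.

Lemma segment_pointsP (R : realType) (u v y : 'rV[int]_2) :
  reflect (lattice_conv R u v y) (y \in segment_points u v).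
Proof.
rewrite /segment_points; set g := gcdn _ _.
have gk k : (g%:Z %| (v - u) (0%R : 'I_1) k)%Z.
  case: (unliftP 0 k) => [j ->|->]; last by rewrite dvdzE /= dvdn_gcdl.
  rewrite (ord1 j) (_ : lift 0 0 = 1); last exact/val_inj.
  by rewrite dvdzE /= dvdn_gcdr.
pose q k := divz ((v - u) 0 k) g.
have dE k : v 0 k - u 0 k = q k * g%:Z by rewrite divzK // !mxE.
apply: (iffP mapP) => [[j + ->]|/lattice_convP [t /andP[t0 t1] tE]].
  rewrite mem_iota add0n /= => jg.
  apply/lattice_convP; have [g0|g0] := eqVneq g 0%N.
    have -> : j = 0%N by move: jg; rewrite g0 ltnS leqn0 => /eqP.
    exists 0; first by rewrite lexx ler01.
    by move=> k; rewrite mxE mul0r mul0r addr0 subrr.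
  have gR : (g%:R : R) != 0 by rewrite pnatr_eq0.
  exists (j%:R / g%:R).
    rewrite divr_ge0 ?ler0n //= ler_pdivrMr ?ltr0n ?lt0n // mul1r ler_nat.
    by rewrite -ltnS.
  move=> k; rewrite mxE dE addrC addKr !rmorphM /= -!pmulrn -/(q k).
  by field.
have [g0|g0] := eqVneq g 0%N.
  exists 0%N; first by rewrite mem_iota g0.
  apply/rowP => k; rewrite mxE mul0r addr0.
  have := tE k; rewrite dE g0 mulr0 mulr0 => /eqP.
  by rewrite intr_eq0 subr_eq0 => /eqP.
have gR : (0 : R) < g%:R by rewrite ltr0n lt0n.
have [a [b ab]] := Bezoutz ((v - u) 0 0) ((v - u) 0 1).
have {}ab : a * q 0 + b * q 1 = 1.
  have g0' : g%:Z != 0 by rewrite eqz_nat.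
  apply: (mulIf g0'); rewrite mul1r mulrDl -!mulrA !divzK //.
pose j := a * (y 0 0 - u 0 0) + b * (y 0 1 - u 0 1).
have jE : j%:~R = t * g%:R :> R.
  rewrite rmorphD /= !(rmorphM) /= !tE !dE !rmorphM /= -!pmulrn.
  transitivity (t * g%:R * (a * q 0 + b * q 1)%:~R); last by rewrite ab mulr1.
  by rewrite rmorphD !rmorphM /=; ring.
have j0 : 0 <= j by rewrite -(ler0z R) jE mulr_ge0 // ltW.
have jg : j <= g%:Z by rewrite -(ler_int R) jE -pmulrn ler_piMl // ltW.
exists `|j|%N; first by rewrite mem_iota; lia.
apply/rowP => k; rewrite mxE gez0_abs // -/(q k).
apply/eqP; rewrite addrC -subr_eq -(eqr_int R) tE dE !rmorphM /= jE -pmulrn.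
by rewrite mulrAC mulrA.
Qed.

Lemma primitiveP (R : realType) (x : 'rV[int]_2) :
  reflect (primitive R x) (coprime `|x 0 0| `|x 0 1|).
Proof.
have E y : lattice_conv R 0 x y <-> y \in segment_points 0 x.
  by split=> /(segment_pointsP R).
apply: (iffP idP) => [xc|[x0 xP]].
  split.
    by apply: contraTneq xc => ->; rewrite !mxE.
  move=> y /E; rewrite /segment_points subr0 (eqP xc) /= !inE.
  by case/orP => /eqP ->; [left|right]; apply/rowP => k;
    rewrite !mxE ?divz1 ?mul0r ?mul1r add0r.
have g0 : (0 < gcdn `|x (0%R : 'I_1) 0%R| `|x (0%R : 'I_1) 1%R|)%N.
  rewrite gcdn_gt0 !absz_gt0 -negb_and; apply: contra x0 => /andP[/eqP x0 /eqP x1].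
  by apply/eqP/rV2P; rewrite ?x0 ?x1 mxE.
rewrite /coprime; set g := gcdn _ _ in g0 *.
have gk k : (g%:Z %| x (0%R : 'I_1) k)%Z.
  case: (unliftP 0 k) => [j ->|->]; last by rewrite dvdzE /= dvdn_gcdl.
  rewrite (ord1 j) (_ : lift 0 0 = 1); last exact/val_inj.
  by rewrite dvdzE /= dvdn_gcdr.
pose y : 'rV[int]_2 := \row_k divz (x 0 k) g.
have xE : x = g%:Z *: y by apply/rowP => k; rewrite !mxE mulrC divzK.
have /xP [y0|yx] : lattice_conv R 0 x y.
- apply/E/mapP; exists 1%N; first by rewrite mem_iota subr0 -/g add0n ltnS g0.
  by rewrite subr0; apply/rowP => k; rewrite !mxE mul1r add0r.
- by move: x0; rewrite xE y0 scaler0 eqxx.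
have [k xk] : exists k, x 0 k != 0 by apply/rV0Pn.
move: xE => /rowP/(_ k); rewrite mxE yx => /eqP.
by rewrite -{1}[x 0 k]mul1r (inj_eq (mulIf xk)) eq_sym.
Qed.

Lemma pairingE (u x : 'rV[int]_2) : pairing u x = u 0 0 * x 0 0 + u 0 1 * x 0 1.
Proof.
rewrite /pairing mxE big_ord_recl big_ord1 !mxE.
by rewrite (_ : lift _ _ = 1) //; exact/val_inj.
Qed.

Lemma det2E (x y : 'rV[int]_2) : det2 x y = x 0 0 * y 0 1 - x 0 1 * y 0 0.
Proof.
have E0 k : (col_mx x y : 'M[int]_2) 0 k = x 0 k.
  by rewrite -(col_mxEu x y 0 k); congr (col_mx x y _ k); exact/val_inj.
have E1 k : (col_mx x y : 'M[int]_2) 1 k = y 0 k.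
  by rewrite -(col_mxEd x y 0 k); congr (col_mx x y _ k); exact/val_inj.
rewrite /det2 -!E0 -!E1; move: (col_mx x y : 'M[int]_2) => {E0 E1} M.
rewrite (expand_det_row _ 0) big_ord_recl big_ord1 /cofactor !det_mx11 !mxE.
transitivity (M 0 0 * ((-1) ^+ 0 * M 1 1) + M 0 1 * ((-1) ^+ 1 * M 1 0)).
  by congr (_ * (_ * _) + _ * (_ * _)); congr (M _ _); exact/val_inj.
by ring.
Qed.

Lemma outer_normal_unique (R : realType) (l : nat) (x y u v : 'rV[int]_2) :
  det2 x y != 0 ->
  is_outer_normal R l x y u -> is_outer_normal R l x y v -> u = v.
Proof.
rewrite det2E => D [_ ux uy] [_ vx vy].
move: ux uy vx vy; rewrite !pairingE => ux uy vx vy.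
apply: rV2P; apply: (mulIf D).
  transitivity (l%:Z * y 0 1 - l%:Z * x 0 1).
    by rewrite -{1}ux -uy; ring.
  by rewrite -{1}vx -vy; ring.
transitivity (l%:Z * x 0 0 - l%:Z * y 0 0).
  by rewrite -{1}uy -ux; ring.
by rewrite -{1}vy -vx; ring.
Qed.

Lemma outer_normalP (R : realType) (l : nat) (x y : 'rV[int]_2) :
  primitive R (y - x) -> det2 x y = l%:Z \/ det2 x y = - l%:Z ->
  is_outer_normal R l x y (outer_normal R l x y).
Proof.
move=> /primitiveP xy D; rewrite /outer_normal; apply: xgetPex.
pose n (s : int) : 'rV[int]_2 :=
  \row_k (if k == 0 then s * (y - x) 0 1 else - s * (y - x) 0 0).
have nP s : `|s|%N = 1%N -> primitive R (n s).
  move=> s1; apply/primitiveP; rewrite !mxE /= !abszM abszN s1 !mul1n coprime_sym.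
  by move: xy; rewrite !mxE.
move: D; rewrite det2E => -[D|D]; [exists (n 1)|exists (n (- 1))]; split;
  try exact: nP; rewrite pairingE !mxE /= -?D; try lia.
all: ring.
Qed.

(* Main.v *)
Require Import Defs.
From HB Require Import structures.
From mathcomp Require Import all_boot all_order all_algebra.
From mathcomp Require Import all_classical all_reals all_analysis.
From mathcomp Require Import ring lra zify.

Import Order.TTheory GRing.Theory Num.Theory.
Local Open Scope ring_scope.

(* Write det(x_i, x_{i+1}) = e_i l with e_i = +-1.  The loop conditions give
   integers b_i with e_{i-1} x_{i-1} + e_i x_{i+1} = b_i x_i, and the edge of the
   dual loop at x_i has length e_{i-1} + e_i - b_i, so that the two lengths add up
   to the sum of 3 e_i - b_i.  Let p be a primitive linear form not vanishing at
   any x_i.  Modulo p(x_i) we have e_i p(x_{i+1}) = - e_{i-1} p(x_{i-1}), so in the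
   sum over i of e_i (s(p_i, p_{i+1}) + s(p_{i+1}, p_i)) the Dedekind sums cancel;
   by Dedekind reciprocity what remains is that the sum of b_i equals
   3 times that of e_i sgn(p_i) sgn(p_{i+1}).  Hence the total is 6 times the
   number of edges crossing the line p = 0, counted with the sign e_i, and each
   such crossing is half a turn around the origin. *)

(** * The length of the dual loop *)

Section CyclicSums.
Variables (T : eqType) (V : zmodType) (f : T -> T -> V).

(** The starting point is kept apart from the sequence, so that sums over concatenated paths add up,
    joined at [last]. *)
Fixpoint path_sum (x : T) (s : seq T) : V :=
  if s is y :: s' then f x y + path_sum y s' else 0.

Lemma path_sum_cat (x : T) (s1 s2 : seq T) :
  path_sum x (s1 ++ s2) = path_sum x s1 + path_sum (last x s1) s2.
Proof. by elim: s1 x => [|y s1 IH] x /=; rewrite ?add0r // IH addrA. Qed.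

Lemma path_sumE (x0 x : T) (s : seq T) :
  path_sum x s = \sum_(i < size s) f (nth x0 (x :: s) i) (nth x0 s i).
Proof.
elim: s x => [|y s IH] x /=; first by rewrite big_ord0.
by rewrite big_ord_recl /= IH.
Qed.

Lemma cyclic_sumE (x0 x : T) (s : seq T) :
  \sum_(i < (size s).+1) f (nth x0 (x :: s) (i %% (size s).+1))
                           (nth x0 (x :: s) (i.+1 %% (size s).+1))
    = path_sum (last x s) (x :: s).
Proof.
rewrite big_ord_recr /= modnn modn_small // (path_sumE x0) addrC /=.
congr (f _ _ + _); first exact: nth_last (x :: s).
by apply: eq_bigr => i _; rewrite !modn_small //= ltnS // ltnW.
Qed.

Hypothesis fxx : forall x, f x x = 0.

Lemma path_sum_drop_repeats (x : T) (s : seq T) :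
  path_sum x (drop_repeats x s) = path_sum x s.
Proof.
elim: s x => [//|y s IH] x /=; case: eqVneq => [->|_] /=; rewrite IH //.
by rewrite fxx add0r.
Qed.

Lemma last_drop_repeats (x : T) (s : seq T) :
  last x (drop_repeats x s) = last x s.
Proof. by elim: s x => [//|y s IH] x /=; case: eqVneq => [->|_] /=. Qed.

(** A repeated entry contributes [f x x = 0], so dropping it is harmless; starting the path at the
    last entry accounts for the closing pair. In the constant case both sides vanish. *)
Lemma cyclic_sum_drop_repeats (x0 x : T) (s : seq T) :
  let s' := drop_cyclic_repeats (x :: s) in
  \sum_(i < size s') f (nth x0 s' (i %% size s'))
                       (nth x0 s' (i.+1 %% size s'))
    = path_sum (last x s) (x :: s).
Proof.
rewrite /drop_cyclic_repeats; case: ifP => [|_].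
  rewrite /= big_ord1 !modn1 fxx => /all_pred1P ->.
  elim: (size s) => [|n IH] /=; first by rewrite fxx addr0.
  by rewrite fxx add0r -IH.
rewrite -[RHS]path_sum_drop_repeats.
have := last_drop_repeats (last x s) (x :: s).
case: (drop_repeats _ _) => [|y r] /= lastE; first by rewrite big_ord0.
by rewrite cyclic_sumE lastE.
Qed.

End CyclicSums.

Arguments path_sum {T V}.

Lemma det2_self (x : 'rV[int]_2) : det2 x x = 0.
Proof. by rewrite det2E mulrC subrr. Qed.

Lemma iota_rcons m n : iota m n.+1 = rcons (iota m n) (m + n)%N.
Proof. by rewrite -addn1 iotaD cats1. Qed.

Lemma last_segment_points z u v : last z (segment_points u v) = v.
Proof.
rewrite /segment_points; set d := v - u; set g := gcdn _ _.
rewrite iota_rcons map_rcons last_rcons add0n.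
have g0 : (g%:Z %| d 0%R 0%R)%Z by rewrite dvdzE /= dvdn_gcdl.
have g1 : (g%:Z %| d 0%R 1%R)%Z by rewrite dvdzE /= dvdn_gcdr.
by apply: rV2P; rewrite mxE [X in _ + X]mulrC divzK // !mxE; ring.
Qed.

(** The points lie on one line through [u], so [det2 u y + det2 y z = det2 u z] for consecutive [y],
    [z], and the sum telescopes. *)
Lemma path_sum_segment_points u v :
  path_sum det2 u (segment_points u v) = det2 u v.
Proof.
rewrite -[in RHS](last_segment_points u u v) /segment_points.
set d := v - u; set g := gcdn _ _; set F := (F in map F _).
elim: g.+1 => [|n IH]; first by rewrite /= det2_self.
rewrite iota_rcons map_rcons last_rcons -cats1 path_sum_cat {}IH /= add0n addr0.
case: n => [|n]; first by rewrite /= det2_self add0r.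
rewrite iota_rcons map_rcons last_rcons add0n !det2E !mxE.
by move: (divz _ _) (divz _ _) => a b; ring.
Qed.

(** For [a = 0] this is the dual loop before repetitions are dropped; the free start [a] serves the
    induction. *)
Definition polygon (u : nat -> 'rV[int]_2) a n : seq 'rV[int]_2 :=
  flatten [seq segment_points (u i) (u i.+1) | i <- iota a n].

Lemma polygonS u a n :
  polygon u a n.+1 = segment_points (u a) (u a.+1) ++ polygon u a.+1 n.
Proof. by []. Qed.

Lemma last_polygon u a n : last (u a) (polygon u a n) = u (a + n)%N.
Proof.
elim: n a => [|n IH] a; first by rewrite addn0.
by rewrite polygonS last_cat last_segment_points IH addSnnS.
Qed.

Lemma path_sum_polygon u a n :
  path_sum det2 (u a) (polygon u a n) =
    \sum_(i < n) det2 (u (a + i)%N) (u (a + i).+1).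
Proof.
elim: n a => [|n IH] a; first by rewrite big_ord0.
rewrite polygonS path_sum_cat last_segment_points path_sum_segment_points IH.
rewrite big_ord_recl addn0; congr (_ + _).
by apply: eq_bigr => i _; rewrite addSnnS.
Qed.

Lemma pt_period P i : pt P (i + size P)%N = pt P i.
Proof. by rewrite /pt modnDr. Qed.

Lemma dual_loop_lengthE (R : realType) l P :
  let u i := outer_normal R l (pt P i) (pt P i.+1) in
  (0 < size P)%N ->
  loop_length l (dual_loop R l P) =
    (\sum_(i < size P) det2 (u i) (u i.+1))%:~R / l%:R.
Proof.
move=> u P0; rewrite /loop_length -mulr_suml -rmorph_sum /=.
congr (_%:~R / _); rewrite /dual_loop -/u -/(polygon u 0 (size P)).
have uT : u (size P) = u 0%N by rewrite /u -[size P]add0n -addSn !pt_period.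
move: (path_sum_polygon u 0 (size P)) (last_polygon u 0 (size P)).
under [X in _ = X -> _]eq_bigr do rewrite add0n.
rewrite add0n uT; case: (polygon _ _ _) => [|x s] <- /= lastE.
  by rewrite big_ord0.
by rewrite /pt (cyclic_sum_drop_repeats _ _ det2 det2_self) /= lastE.
Qed.

(** * Relations between three consecutive lattice points and their edge normals *)

Lemma primitive_colinear (R : realType) (x y : 'rV[int]_2) :
  primitive R x -> det2 x y = 0 -> exists b : int, y = b *: x.
Proof.
move=> /primitiveP xc; rewrite det2E => xy.
have [u [v uv]] := Bezoutz (x 0 0) (x 0 1).
have {}uv : u * x 0 0 + v * x 0 1 = 1 by rewrite uv /gcdz (eqP xc).
(* The Bezout form [(u, v)] takes the value 1 at [x], so its value at [y] is the factor. *)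
exists (u * y 0 0 + v * y 0 1); apply: rV2P; rewrite mxE.
  transitivity (y 0 0 * (u * x 0 0 + v * x 0 1)); first by rewrite uv mulr1.
  transitivity ((u * y 0 0 + v * y 0 1) * x 0 0
    - v * (x 0 0 * y 0 1 - x 0 1 * y 0 0)); first by ring.
  by rewrite xy mulr0 subr0.
transitivity (y 0 1 * (u * x 0 0 + v * x 0 1)); first by rewrite uv mulr1.
transitivity ((u * y 0 0 + v * y 0 1) * x 0 1
  + u * (x 0 0 * y 0 1 - x 0 1 * y 0 0)); first by ring.
by rewrite xy mulr0 addr0.
Qed.

(** The two edges are parallel and primitive, hence equal up to sign. Opposite edges would give
    [z = x], a degenerate segment forcing [y = x]. *)
Lemma midpoint_of_primitive (R : realType) (x y z : 'rV[int]_2) :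
  primitive R (y - x) -> primitive R (z - y) -> lattice_conv R x z y ->
  x + z = y *+ 2.
Proof.
move=> xy yz /lattice_convP [s _ sE].
have yx0 : y - x != 0 by case: xy.
have D : det2 (y - x) (z - y) = 0.
  apply/eqP; rewrite -(intr_eq0 R) det2E !mxE rmorphB !rmorphM /=.
  have zyE k : (z 0 k - y 0 k)%:~R = (1 - s) * (z 0 k - x 0 k)%:~R :> R.
    have -> : z 0 k - y 0 k = (z 0 k - x 0 k) - (y 0 k - x 0 k) by ring.
    by rewrite rmorphB /= sE; ring.
  by rewrite !sE !zyE; apply/eqP; ring.
have [c zy] := primitive_colinear _ _ _ xy D.
have c1 : `|c|%N = 1%N.
  move/primitiveP: yz; rewrite zy !mxE !abszM /coprime -muln_gcdr.
  by rewrite muln_eq1 => /andP[/eqP].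
suff c1' : c = 1 by rewrite -[z](subrK y) zy c1' scale1r mulr2n [_ + y]addrC addrCA subrKC.
have : c = 1 \/ c = -1 by lia.
case=> // cN; have zx : z = x by apply: (addIr (- y)); rewrite zy cN scaleN1r opprB.
case/eqP: yx0; apply: rV2P; have := sE 0; have := sE 1;
  by rewrite zx !mxE !subrr mulr0 => /eqP; rewrite intr_eq0 => /eqP ? /eqP; rewrite intr_eq0 => /eqP.
Qed.

(* At a vertex primitivity makes the coefficient integral; elsewhere x_{i+1} is
   the midpoint of its neighbours. *)
Lemma loop_recurrence (R : realType) l P i (e e' : int) :
  (0 < l)%N -> reflexive_loop R l P -> e = 1 \/ e = -1 -> e' = 1 \/ e' = -1 ->
  det2 (pt P i) (pt P i.+1) = e * l%:Z ->
  det2 (pt P i.+1) (pt P i.+2) = e' * l%:Z ->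
  exists b : int, e *: pt P i + e' *: pt P i.+2 = b *: pt P i.+1.
Proof.
move=> l0 [_ H] e1 e1'; have [_ xy _ V] := H i; have [_ yz _ _] := H i.+1.
move: V xy yz; move: (pt P i) (pt P i.+1) (pt P i.+2) => x y z V xy yz D D'.
have [xyz|/V] := EM (lattice_conv R x z y); last first.
  move/primitive_colinear; apply; move: D D'; rewrite !det2E !mxE => D D'.
  transitivity (e' * (y 0 0 * z 0 1 - y 0 1 * z 0 0)
                - e * (x 0 0 * y 0 1 - x 0 1 * y 0 0)); first by ring.
  by rewrite D D' !mulrA; case: e1 => ->; case: e1' => ->; ring.
have M := midpoint_of_primitive _ _ _ _ xy yz xyz.
have zE : z = y *+ 2 - x by rewrite -M addrC addrA addNr add0r.
(* With [z = 2y - x] both edges have the same determinant, so the signs agree and the coefficient is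
   [2e]. *)
have ee : e' = e.
  have : e' * l%:Z = e * l%:Z.
    by rewrite -D -D' !det2E zE !mxE; ring.
  by apply: mulIf; lia.
by exists (e * 2); rewrite ee -scalerDr M -scalerA scaler_nat.
Qed.

(** Each normal is the edge vector turned by a quarter turn, times the sign of the edge. Turning
    preserves determinants, so [det2 u v] is [e * e'] times that of the two edge vectors. *)
Lemma det2_outer_normals (l e e' : int) (x y z u v : 'rV[int]_2) :
  e * e = 1 -> e' * e' = 1 ->
  det2 x y = e * l -> det2 y z = e' * l -> l != 0 ->
  pairing u x = l -> pairing u y = l -> pairing v y = l -> pairing v z = l ->
  det2 u v = l * (e + e') - e * e' * det2 x z.
Proof.
move=> ee ee' D D' l0 ux uy vy vz.
have normal (a b w : 'rV[int]_2) (d : int) : d * d = 1 -> det2 a b = d * l ->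
    pairing w a = l -> pairing w b = l ->
    w 0 0 = d * (b 0 1 - a 0 1) /\ w 0 1 = - d * (b 0 0 - a 0 0).
  rewrite det2E !pairingE => dd Dd wa wb.
  have dl : d * l != 0.
    by rewrite mulf_neq0 //; apply: contra_eqN dd => /eqP ->; rewrite mulr0.
  split; apply: (mulIf dl).
    transitivity (d * d * (l * b 0 1 - l * a 0 1)); last by ring.
    by rewrite -{1}Dd dd -{1}wa -wb; ring.
  transitivity (d * d * (l * a 0 0 - l * b 0 0)); last by ring.
  by rewrite -{1}Dd dd -{1}wb -wa; ring.
have [u0 u1] := normal _ _ _ _ ee D ux uy.
have [v0 v1] := normal _ _ _ _ ee' D' vy vz.
move: D D'; rewrite [det2 u v]det2E u0 u1 v0 v1 !det2E => D D'.
transitivity (e * e' * ((y 0 0 * z 0 1 - y 0 1 * z 0 0)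
   + (x 0 0 * y 0 1 - x 0 1 * y 0 0) - (x 0 0 * z 0 1 - x 0 1 * z 0 0))); first by ring.
rewrite D D'.
transitivity (l * (e * (e' * e') + (e * e) * e') - e * e' * (x 0 0 * z 0 1 - x 0 1 * z 0 0)); first by ring.
by rewrite ee ee' mulr1 mul1r.
Qed.

(** * Dedekind sums *)

(** The right side of Dedekind reciprocity for 12 s(q/g, p/g) with g the gcd; the square of g comes
    from clearing the common factor. *)
Definition reciprocity_term (q p : nat) : rat :=
  q%:R / p%:R + p%:R / q%:R + (gcdn q p)%:R ^+ 2 / (q%:R * p%:R) - 3%:R.

Lemma reciprocity_termC q p : reciprocity_term q p = reciprocity_term p q.
Proof.
rewrite /reciprocity_term gcdnC [q%:R * p%:R]mulrC.
by rewrite [X in X + _ - _]addrC.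
Qed.

(* Euclid's algorithm, with the correction that makes reciprocity hold at each
   step. *)
Fixpoint dedekind_fuel (n q p : nat) : rat :=
  if n is n'.+1 then
    let r := (q %% p)%N in
    if r == 0%N then 0 else reciprocity_term r p - dedekind_fuel n' p r
  else 0.

Lemma dedekind_fuel_indep n m q p : (0 < p)%N -> (p <= n)%N -> (p <= m)%N ->
  dedekind_fuel n q p = dedekind_fuel m q p.
Proof.
elim: n m q p => [|n IH] [|m] q p p0 pn pm; try lia.
rewrite /=; case: eqVneq => // r0; congr (_ - _).
have := ltn_pmod q p0; move: r0; set r := (q %% p)%N => r0 rp.
by apply: IH; lia.
Qed.

Definition dedekind_nat (q p : nat) : rat := dedekind_fuel p q p.

Lemma dedekind_nat_mod q p : dedekind_nat (q %% p) p = dedekind_nat q p.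
Proof. by rewrite /dedekind_nat; case: p => //= p; rewrite modn_mod. Qed.

Lemma dedekind_nat_0 p : dedekind_nat 0 p = 0.
Proof. by rewrite /dedekind_nat; case: p => //= p; rewrite mod0n. Qed.

(** For [q < p] this is one unfolding of the recursion, and the law is symmetric. For [q = p] both
    sides are 0. *)
Lemma dedekind_nat_reciprocity q p : (0 < q)%N -> (0 < p)%N ->
  dedekind_nat q p + dedekind_nat p q = reciprocity_term q p.
Proof.
have lt_case a b : (0 < a)%N -> (a < b)%N ->
    dedekind_nat a b + dedekind_nat b a = reciprocity_term a b.
  move=> a0 ab; rewrite /dedekind_nat; case: b ab => // b ab /=.
  rewrite modn_small // -[a == 0%N]negbK -lt0n a0 /=.
  by rewrite (dedekind_fuel_indep b a) // subrK.
move=> q0 p0; case: (ltngtP q p) => [qp|pq|->].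
- exact: lt_case.
- by rewrite addrC reciprocity_termC; exact: lt_case.
- rewrite -dedekind_nat_mod modnn dedekind_nat_0 /reciprocity_term gcdnn.
  have : (p%:R : rat) != 0 by rewrite pnatr_eq0 -lt0n.
  by move: (p%:R) => x x0; field.
Qed.

(* The three reciprocity laws along the Farey triangle q, p - q, p combine to
   oddness. *)
Lemma dedekind_nat_sub q p : (0 < q)%N -> (q < p)%N ->
  dedekind_nat (p - q) p = - dedekind_nat q p.
Proof.
move=> q0 qp; have d0 : (0 < p - q)%N by lia.
have R1 := dedekind_nat_reciprocity _ _ d0 (ltn_trans q0 qp).
have R2 := dedekind_nat_reciprocity _ _ q0 d0.
have R3 := dedekind_nat_reciprocity _ _ (ltn_trans q0 qp) q0.
have P1 : dedekind_nat p (p - q) = dedekind_nat q (p - q).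
  by rewrite -(dedekind_nat_mod p) -(dedekind_nat_mod q) -{1}(subnK (ltnW qp)) modnDl.
have P2 : dedekind_nat p q = dedekind_nat (p - q) q.
  by rewrite -(dedekind_nat_mod p) -(dedekind_nat_mod (p - q)) -{1}(subnK (ltnW qp)) modnDr.
(* In [R1 - R2 + R3] the sums with moduli [p - q] and [q] cancel by [P1] and [P2], so oddness
   amounts to this identity. *)
have E : reciprocity_term (p - q) p - reciprocity_term q (p - q)
         + reciprocity_term p q = 0.
  have g2 : gcdn q (p - q) = gcdn q p by rewrite -{2}(subnK (ltnW qp)) gcdnDr.
  have g1 : gcdn (p - q) p = gcdn q p.
    by rewrite -{2}(subnK (ltnW qp)) gcdnDl gcdnC.
  rewrite /reciprocity_term g1 g2 (gcdnC p) natrB ?(ltnW qp) //.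
  have q1 : (q%:R : rat) != 0 by rewrite pnatr_eq0 -lt0n.
  have p1 : (p%:R : rat) != 0 by rewrite pnatr_eq0; lia.
  have d1 : (p%:R : rat) - q%:R != 0 by rewrite -natrB ?(ltnW qp) // pnatr_eq0 -lt0n.
  move: (gcdn q p)%:R q1 p1 d1 => g; move: (q%:R) (p%:R) => y x y0 x0 xy0.
  by field; rewrite x0 y0 xy0.
lra.
Qed.

(* 12 s(q / g, p / g) for p > 0 and g = gcd(q, p), made odd in p as well. *)
Definition dedekind (q p : int) : rat :=
  (Num.sg p)%:~R * dedekind_nat `|(q %% p)%Z| `|p|.

Lemma dedekind_mod q p b : dedekind (b * p + q) p = dedekind q p.
Proof. by rewrite /dedekind modzMDl. Qed.

Lemma dedekindNr q p : dedekind q (- p) = - dedekind q p.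
Proof. by rewrite /dedekind sgrN rmorphN mulNr modzN abszN. Qed.

(** For positive modulus [m] a nonzero residue [r] becomes [m - r], where [dedekind_nat_sub]
    applies; residue 0 is treated apart, and oddness in [p] covers negative moduli. *)
Lemma dedekindNl q p : dedekind (- q) p = - dedekind q p.
Proof.
have pos m : (0 < m)%N -> dedekind (- q) m%:Z = - dedekind q m%:Z.
  move=> m0; rewrite /dedekind -mulrN; congr (_ * _); rewrite absz_nat.
  have r0 : 0 <= (q %% m)%Z by apply: modz_ge0; lia.
  have rm : (q %% m)%Z < m%:Z by apply: ltz_pmod; lia.
  have -> : ((- q) %% m)%Z = ((- (q %% m)%Z) %% m)%Z by rewrite modzNm.
  case: ((q %% m)%Z) r0 rm => // r _ rm.
  case: r rm => [|r] rm; first by rewrite oppr0 mod0z dedekind_nat_0 oppr0.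
  have -> : (- r.+1%:Z %% m)%Z = (m - r.+1)%N.
    have -> : - r.+1%:Z = -1 * m%:Z + (m - r.+1)%N%:Z by lia.
    by rewrite modzMDl modz_small //; lia.
  by rewrite /= dedekind_nat_sub //; lia.
have [p0|p0|->] := ltrgtP p 0.
- rewrite -(opprK p) !(dedekindNr _ (- p)) -[- p]gez0_abs ?oppr_ge0 ?ltW //.
  by rewrite pos // ; lia.
- by rewrite -[p]gez0_abs ?ltW // pos //; lia.
- by rewrite /dedekind sgr0 !mul0r oppr0.
Qed.

(** Both sides are symmetric and odd in each argument, which reduces the law to positive
    integers. *)
Lemma dedekind_reciprocity q p : q != 0 -> p != 0 ->
  dedekind q p + dedekind p q =
    q%:~R / p%:~R + p%:~R / q%:~R + (gcdz q p)%:~R ^+ 2 / (q%:~R * p%:~R)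
    - 3%:R * (Num.sg q)%:~R * (Num.sg p)%:~R.
Proof.
pose goal (q p : int) := dedekind q p + dedekind p q =
    q%:~R / p%:~R + p%:~R / q%:~R + (gcdz q p)%:~R ^+ 2 / (q%:~R * p%:~R)
    - 3%:R * (Num.sg q)%:~R * (Num.sg p)%:~R.
rewrite -/(goal q p).
have goalC a b : goal a b -> goal b a.
  rewrite /goal addrC => ->; rewrite gcdzC [b%:~R * a%:~R]mulrC.
  rewrite [X in X + _ - _ = _]addrC; ring.
have goalN a b : goal a b -> goal a (- b).
  rewrite /goal dedekindNr dedekindNl gcdzN sgrN !rmorphN /= invrN !mulrN.
  rewrite -opprD => ->; rewrite invrN; ring.
have pos m n : (0 < m)%N -> (0 < n)%N ->
    goal m n.
  move=> m0 n0; rewrite /goal /dedekind !gtr0_sg ?ltz_nat // !mul1r !modz_nat !absz_nat.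
  by rewrite !dedekind_nat_mod dedekind_nat_reciprocity // !mulr1.
have pos_l m b : (0 < m)%N -> b != 0 -> goal m%:Z b.
  move=> m0; have [b0|b0|->] := ltrgtP b 0 => // _.
    rewrite -(opprK b) -[- b]gez0_abs ?oppr_ge0 ?ltW //; apply: goalN.
    by rewrite /goal pos //; lia.
  by rewrite -[b]gez0_abs ?ltW // /goal pos //; lia.
have [q0|q0|->] := ltrgtP q 0 => // _ p0.
  rewrite -(opprK q) -[- q]gez0_abs ?oppr_ge0 ?ltW //; apply/goalC/goalN/goalC.
  by apply: pos_l => //; lia.
by rewrite -[q]gez0_abs ?ltW //; apply: pos_l => //; lia.
Qed.

(** * Summing reciprocity along a periodic sequence *)

Lemma sum_cyclic_shift (V : zmodType) (f : nat -> V) n :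
  f n = f 0%N -> \sum_(i < n) f i.+1 = \sum_(i < n) f i.
Proof.
move=> fn; apply: (@addIr _ (f 0%N)).
by rewrite addrC -(big_ord_recl n (fun i => f i)) big_ord_recr /= fn.
Qed.

Lemma sqr_unit_int (e : int) : e = 1 \/ e = -1 -> e * e = 1.
Proof. by case=> ->. Qed.

(* Reciprocity is summed along the sequence: periodicity and oddness cancel the
   Dedekind sums at each vertex, the gcd terms telescope because
   e_i l / (p_i p_{i+1}) = q_{i+1} / p_{i+1} - q_i / p_i. *)
Lemma sum_curvature (t : nat) (l : int) (p q e b : nat -> int) :
  l != 0 -> (forall i, p i != 0) -> (forall i, e i = 1 \/ e i = -1) ->
  (forall i, p (i + t)%N = p i) -> (forall i, q (i + t)%N = q i) ->
  (forall i, e (i + t)%N = e i) ->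
  (forall i, p i * q i.+1 - q i * p i.+1 = e i * l) ->
  (forall i, e i * p i + e i.+1 * p i.+2 = b i * p i.+1) ->
  \sum_(i < t) b i = 3 * \sum_(i < t) e i * Num.sg (p i) * Num.sg (p i.+1).
Proof.
move=> l0 p0 e1 pt qt et pq pb.
have ee i := sqr_unit_int _ (e1 i).
(* The outer coefficients of the recurrence are units, so consecutive pairs share one gcd; this
   makes the factor of the telescoping term constant. *)
have gcdE i : gcdz (p i) (p i.+1) = gcdz (p 0%N) (p 1%N).
  elim: i => // i <-; rewrite gcdzC.
  have -> : p i.+2 = (e i.+1 * b i) * p i.+1 + - (e i.+1 * e i) * p i.
    have := pb i; have := ee i.+1; move: (e i.+1) (p i.+2) => e' p' ee' E.
    rewrite -mulrA -E mulrDr [e' * (e' * _)]mulrA ee'; ring.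
  rewrite gcdzC gcdzMDl mulNr gcdzN.
  by case: (e1 i) => ->; case: (e1 i.+1) => ->;
    rewrite ?mulr1 ?mulrN1 ?opprK ?mulN1r ?mul1r ?gcdzN gcdzC.
pose P i : rat := (p i)%:~R; pose Q i : rat := (q i)%:~R.
pose E i : rat := (e i)%:~R; pose L : rat := l%:~R.
have P0 i : P i != 0 by rewrite intr_eq0.
have L0 : L != 0 by rewrite intr_eq0.
have EE i : E i * E i = 1 by rewrite -rmorphM /= ee.
have PQ i : P i * Q i.+1 - Q i * P i.+1 = E i * L.
  by rewrite -!rmorphM -rmorphB pq.
have per (f : nat -> int) : (forall i, f (i + t)%N = f i) -> f t = f 0%N.
  by move=> H; rewrite -[t]add0n H.
have per1 (f : nat -> int) : (forall i, f (i + t)%N = f i) -> f t.+1 = f 1%N.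
  by move=> H; rewrite -[t.+1]add1n H.
have Sz : \sum_(i < t) E i * (dedekind (p i) (p i.+1) + dedekind (p i.+1) (p i)) = 0.
  under eq_bigr do rewrite mulrDr; rewrite big_split /=.
  rewrite -[X in _ + X](sum_cyclic_shift _ (fun i => E i * dedekind (p i.+1) (p i))); last first.
    by rewrite /E (per p) // (per1 p) // (per e).
  rewrite -big_split big1 //= => i _.
  (* Oddness moves the signs inside; the two first arguments then add up to [b i * p i.+1], which is
     0 modulo [p i.+1]. *)
  have EN j a c : E j * dedekind a c = dedekind (e j * a) c.
    by rewrite /E; case: (e1 j) => ->; rewrite ?mul1r ?rmorphN ?mulN1r ?dedekindNl.
  rewrite !EN; have -> : e i.+1 * p i.+2 = b i * p i.+1 + - (e i * p i).
    by rewrite -pb; ring.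
  by rewrite dedekind_mod dedekindNl subrr.
pose G : rat := (gcdz (p 0%N) (p 1%N))%:~R.
have step i : E i * (dedekind (p i) (p i.+1) + dedekind (p i.+1) (p i)) =
    E i * (P i / P i.+1) + E i * (P i.+1 / P i)
    + G ^+ 2 / L * (Q i.+1 / P i.+1 - Q i / P i)
    - 3 * (e i * Num.sg (p i) * Num.sg (p i.+1))%:~R.
  rewrite dedekind_reciprocity // gcdE -/(P i) -/(P i.+1) -/G.
  have -> : Q i.+1 / P i.+1 - Q i / P i = E i * L / (P i * P i.+1).
    by rewrite -PQ; field; rewrite !P0.
  rewrite !rmorphM /= -/(E i); field; by rewrite L0 !P0.
(* The two ratios of the reciprocity law recombine to [b i] once the second is shifted by one
   index. *)
have bE i : (b i)%:~R = E i * (P i / P i.+1) + E i.+1 * (P i.+2 / P i.+1).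
  apply: (mulIf (P0 i.+1)); rewrite -rmorphM -pb rmorphD !rmorphM /=.
  rewrite -/(E i) -/(E i.+1) -/(P i) -/(P i.+2); field; exact: P0.
move: Sz; under eq_bigr do rewrite step.
rewrite !big_split /= -mulr_sumr sumrB.
rewrite (sum_cyclic_shift _ (fun i => Q i / P i)); last first.
  by rewrite /Q /P (per p) // (per q).
rewrite subrr mulr0 addr0.
rewrite -[X in _ + X + _](sum_cyclic_shift _ (fun i => E i * (P i.+1 / P i))); last first.
  by rewrite /E /P (per p) // (per1 p) // (per e).
rewrite -big_split /=; under eq_bigr do rewrite -bE.
rewrite sumrN -mulr_sumr -!rmorph_sum /= => /eqP.
rewrite subr_eq0 => /eqP H; apply/eqP; rewrite -(eqr_int rat) H rmorphM //.
Qed.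

(** * The winding number *)

Section Angles.
Import numFieldNormedType.Exports.
Local Open Scope classical_set_scope.
Local Open Scope ring_scope.
Variable R : realType.
Implicit Types (a x r : R) (k : int).

Lemma cosDpi_int x k : cos (x + pi * k%:~R) = (-1) ^+ `|k|%N * cos x.
Proof.
case: k => n; first by rewrite -pmulrn mulr_natr (alternatingn (@cosDpi R)).
rewrite NegzE mulrNz mulrN abszN absz_nat -pmulrn mulr_natr.
rewrite -{2}(subrK (pi *+ n.+1) x) (alternatingn (@cosDpi R)) mulrA -exprMn.
by rewrite mulrNN mulr1 expr1n mul1r.
Qed.

(** After reduction to [0, 2 pi), injectivity of [cos] on [0, pi] applies to [y] or to its
    reflection [2 * pi - y]. *)
Lemma cos_eq1 x : cos x = 1 -> exists k, x = 2 * pi * k%:~R.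
Proof.
have pi0 := pi_gt0 R; move=> cx; pose k := Num.floor (x / (2 * pi)).
have tp0 : 0 < 2 * pi :> R by rewrite mulr_gt0.
exists k; pose y := x - 2 * pi * k%:~R.
have cy : cos y = 1.
  have -> : y = x + pi * (- (k * 2))%:~R by rewrite /y rmorphN rmorphM /=; ring.
  by rewrite cosDpi_int abszN abszM exprM sqrr_sign mul1r cx.
have /andP[y0 y2] : 0 <= y < 2 * pi.
  have := floor_itv (x / (2 * pi)); rewrite -/k rmorphD /=.
  by rewrite ler_pdivlMr // ltr_pdivrMr // /y => /andP[? ?]; apply/andP; split; lra.
suff : y = 0 by rewrite /y => /eqP; rewrite subr_eq0 => /eqP.
have [yp|yp] := leP y pi.
  by apply: (@cos_inj R); rewrite ?in_itv /= ?lexx ?y0 ?yp ?(ltW pi0) // cos0.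
have : 2 * pi - y = 0; last by lra.
apply: (@cos_inj R); rewrite ?in_itv /= ?lexx ?(ltW pi0) //; last first.
  rewrite cos0; transitivity (cos y) => //.
  by rewrite -[RHS]cosN -[RHS]cosD2pi mulr2n; congr (cos _); ring.
by apply/andP; split; lra.
Qed.

(** [k] indexes the interval between consecutive zeros of [cos] that contains [x]; its changes count
    signed crossings of the line where [cos] vanishes. *)
Definition half_turn x k := `|x - pi * k%:~R| < pi / 2.

Lemma half_turn_ex x : cos x != 0 -> exists k, half_turn x k.
Proof.
have pi0 := pi_gt0 R; move=> cx; pose k := Num.floor (x / pi + 1 / 2); exists k.
have := floor_itv (x / pi + 1 / 2); rewrite -/k rmorphD /= => /andP[k0 k1].
have field_pi (p : R) : 0 < p -> p * (x / p + 1 / 2) = x + p / 2.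
  by move=> /lt0r_neq0 p0; field.
have E := field_pi _ pi0.
have {}k0 : pi * k%:~R <= x + pi / 2 by rewrite -E ler_pM2l.
have {}k1 : x + pi / 2 < pi * k%:~R + pi.
  by rewrite -E (_ : _ + pi = pi * (k%:~R + 1)) ?ltr_pM2l // mulrDr mulr1.
rewrite /half_turn ltr_norml; apply/andP; split; last by lra.
rewrite lt_neqAle; apply/andP; split; last by lra.
apply: contraNneq cx => xk; rewrite -[x](subrK (pi * k%:~R)) -xk cosDpi_int.
by rewrite cosN cos_pihalf mulr0.
Qed.

Lemma half_turn_sg x k : half_turn x k -> Num.sg (cos x) = (-1) ^+ `|k|%N.
Proof.
rewrite /half_turn ltr_norml => H.
rewrite -[x](subrK (pi * k%:~R)) cosDpi_int sgrM.
by rewrite [X in _ * X]gtr0_sg ?mulr1 ?cos_gt0_pihalf // sgrX sgrN1.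
Qed.

(** An increase by less than pi passes at most one zero of [cos], so [j - k] is 0 or 1, and the
    signs of [cos] decide which. *)
Lemma half_turn_step x y k j : half_turn x k -> half_turn y j -> 0 < y - x < pi ->
  2 * (j - k)%:~R = 1 - Num.sg (cos x) * Num.sg (cos y).
Proof.
have pi0 := pi_gt0 R => hx hy xy.
rewrite (half_turn_sg _ _ hx) (half_turn_sg _ _ hy) -exprD.
have [] : j = k \/ j = k + 1.
  move: hx hy xy; rewrite /half_turn !ltr_norml => /andP[? ?] /andP[? ?] /andP[? ?].
  have : -1 < (j - k)%:~R :> R.
    by rewrite -(ltr_pM2l pi0) rmorphB /= mulrBr; lra.
  have : (j - k)%:~R < 2 :> R.
    by rewrite -(ltr_pM2l pi0) rmorphB /= mulrBr; lra.
  by rewrite (ltr_int _ _ 2) (ltr_int _ (-1)) => ? ?; lia.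
- by move=> ->; rewrite !subrr mulr0 addnn -muln2 exprM sqrr_sign subrr.
- move=> ->; rewrite -signr_odd; have -> : odd (`|k| + `|k + 1|) by lia.
  by rewrite expr1 opprK addrC addKr mulr1.
Qed.

Lemma half_turn_step_sg x y k j e :
  half_turn x k -> half_turn y j -> e \in [:: 1; -1] -> 0 < e * (y - x) < pi ->
  2 * (j - k)%:~R = e * (1 - Num.sg (cos x) * Num.sg (cos y)).
Proof.
move=> hx hy; rewrite !inE => /orP[] /eqP ->.
  by rewrite !mul1r; exact: half_turn_step.
rewrite !mulN1r opprB => H.
rewrite [Num.sg (cos x) * _]mulrC -(half_turn_step _ _ _ _ hy hx H).
by rewrite -mulrN -rmorphN opprB.
Qed.

Definition is_argument (v : 'rV[R]_2) x :=
  exists2 r, 0 < r & v = \row_k (if k == 0 then r * cos x else r * sin x).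

Lemma is_argumentP (v : 'rV[R]_2) x : is_argument v x <->
  exists r, [/\ 0 < r, v 0 0 = r * cos x & v 0 1 = r * sin x].
Proof.
split=> [[r r0 ->]|[r [r0 v0 v1]]]; first by exists r; rewrite !mxE.
exists r => //; apply/rowP => k; rewrite mxE; case: (unliftP 0 k) => [j ->|->] //.
by rewrite (ord1 j) (_ : lift 0 0 = 1) //; exact/val_inj.
Qed.

Lemma is_argument_ex (v : 'rV[R]_2) : v 0 0 != 0 \/ v 0 1 != 0 ->
  exists x, is_argument v x.
Proof.
move: (v 0 0) (v 0 1) (is_argumentP v) => a b vP ab.
have n0 : 0 < a ^+ 2 + b ^+ 2.
  case: ab => H; first by rewrite ltr_wpDr ?sqr_ge0 // exprn_even_gt0.
  by rewrite ltr_wpDl ?sqr_ge0 // exprn_even_gt0.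
pose r := Num.sqrt (a ^+ 2 + b ^+ 2).
have r0 : 0 < r by rewrite sqrtr_gt0.
have rr : r ^+ 2 = a ^+ 2 + b ^+ 2 by rewrite sqr_sqrtr // ltW.
have c1 : -1 <= a / r <= 1.
  by rewrite -ler_norml -(@ler_pXn2r _ 2) ?nnegrE // expr1n real_normK ?num_real //
     expr_div_n ler_pdivrMr ?exprn_gt0 // mul1r rr lerDl sqr_ge0.
have ca : a = r * cos (acos (a / r)) by rewrite acosK // mulrC divfK // gt_eqF.
have sa : (r * sin (acos (a / r))) ^+ 2 = b ^+ 2.
  have := cos2Dsin2 (acos (a / r)); move: ca rr; move: (acos _) => x ca rr cs.
  by rewrite exprMn -(addKr (cos x ^+ 2) (sin x ^+ 2)) cs mulrDr mulr1 mulrN -exprMn -ca rr; ring.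
(* [acos] fixes the angle up to sign; the sign of the second coordinate selects it. *)
move/eqP: sa; rewrite eqf_sqr => /orP[] /eqP sa.
  by exists (acos (a / r)); apply/vP; exists r.
exists (- acos (a / r)); apply/vP; exists r.
by rewrite cosN sinN mulrN sa opprK.
Qed.

Lemma is_argument_eq (v : 'rV[R]_2) x y : is_argument v x -> is_argument v y ->
  exists k, x - y = 2 * pi * k%:~R.
Proof.
move=> /is_argumentP[r [r0 v0 v1]] /is_argumentP[r' [r0' v0' v1']].
apply: cos_eq1; rewrite cosB.
have rr : r = r'.
  have E (z w : R) : w ^+ 2 = (w * cos z) ^+ 2 + (w * sin z) ^+ 2.
    by rewrite !exprMn -mulrDr cos2Dsin2 mulr1.
  apply/eqP; rewrite -(@eqrXn2 _ 2) ?ltW //.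
  by rewrite (E x r) (E y r') -v0 -v1 -v0' -v1'.
have cc : cos x = cos y by apply: (mulfI (lt0r_neq0 r0)); rewrite -v0 v0' rr.
have ss : sin x = sin y by apply: (mulfI (lt0r_neq0 r0)); rewrite -v1 v1' rr.
by rewrite cc ss -!expr2 cos2Dsin2.
Qed.

(* In complex notation, with d = b - a and t(s) the quotient of <d, p(s)> by
   det(a, b), the point p(s) = a + s d equals a (1 + i t(s)) / (1 + i t(0)). *)
Lemma edge_argument (a b : 'rV[R]_2) x :
  let D := a 0 0 * b 0 1 - a 0 1 * b 0 0 in
  D != 0 -> is_argument a x ->
  exists phi : R -> R, [/\ continuous phi, phi 0 = x,
    (forall s, is_argument ((1 - s) *: a + s *: b) (phi s))
    & 0 < Num.sg D * (phi 1 - x) < pi].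
Proof.
move=> D D0 /is_argumentP[r [r0]].
pose t0 := ((b 0 0 - a 0 0) * a 0 0 + (b 0 1 - a 0 1) * a 0 1) / D.
pose t1 := ((b 0 0 - a 0 0) ^+ 2 + (b 0 1 - a 0 1) ^+ 2) / D.
move=> a0 a1; pose phi (s : R) := x + (atan (t0 + s * t1) - atan t0).
exists phi; split.
- move=> s; apply: cvgD; first exact: cvg_cst.
  apply: cvgB; last exact: cvg_cst.
  apply: continuous_cvg; first exact: continuous_atan.
  apply: cvgD; first exact: cvg_cst.
  by apply: cvgM; [exact: cvg_id|exact: cvg_cst].
- by rewrite /phi mul0r addr0 subrr addr0.
- move=> s; apply/is_argumentP; set t := t0 + s * t1.
  have cos_gt0 z : 0 < cos (atan z) :> R.
    by apply: cos_gt0_pihalf; rewrite atan_gtNpi2 atan_ltpi2.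
  have sinE z : sin (atan z) = z * cos (atan z) :> R.
    by rewrite -[z in z * _]atanK /tan divfK // gt_eqF.
  have z0 : 1 + t0 ^+ 2 != 0 by rewrite gt_eqF // ltr_wpDr ?sqr_ge0.
  have c2 : cos (atan t0) ^+ 2 = (1 + t0 ^+ 2)^-1.
    apply: (mulIf z0); rewrite mulVf // -[RHS](cos2Dsin2 (atan t0)) sinE; ring.
  have ct0 := lt0r_neq0 (cos_gt0 t).
  exists (r * cos (atan t0) / cos (atan t)); split.
  + by rewrite divr_gt0 ?mulr_gt0.
  (* Real part of a (1 + i t) (1 - i t0) / (1 + t0^2), by [c2]; the next bullet treats the imaginary
     part. *)
  + transitivity (cos (atan t0) ^+ 2 * (a 0 0 * (1 + t * t0) - a 0 1 * (t - t0))).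
      rewrite c2 !mxE; apply: (mulfI z0); rewrite mulVKf //.
      move: D0; rewrite /t /t0 /t1 /D; move: (a 0 0) (a 0 1) (b 0 0) (b 0 1) => *.
      by field.
    rewrite /phi -/t cosD sinB cosB !sinE a0 a1.
    by move: (cos (atan t)) ct0 => c c0; field.
  + transitivity (cos (atan t0) ^+ 2 * (a 0 1 * (1 + t * t0) + a 0 0 * (t - t0))).
      rewrite c2 !mxE; apply: (mulfI z0); rewrite mulVKf //.
      move: D0; rewrite /t /t0 /t1 /D; move: (a 0 0) (a 0 1) (b 0 0) (b 0 1) => *.
      by field.
    rewrite /phi -/t sinD sinB cosB !sinE a0 a1.
    by move: (cos (atan t)) ct0 => c c0; field.
- rewrite /phi mul1r addrC addKr.
  (* Hence [t1] has the sign of [D], which gives the direction of turning; the turn stays below pi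
     because the range of [atan] has length pi. *)
  have d0 : 0 < (b 0 0 - a 0 0) ^+ 2 + (b 0 1 - a 0 1) ^+ 2.
    rewrite lt_neqAle addr_ge0 ?sqr_ge0 // andbT eq_sym.
    apply: contra D0; rewrite paddr_eq0 ?sqr_ge0 // !sqrf_eq0 !subr_eq0.
    by rewrite /D => /andP[/eqP -> /eqP ->]; apply/eqP; ring.
  have := (atan_gtNpi2 (t0 + t1), atan_ltpi2 (t0 + t1), atan_gtNpi2 t0, atan_ltpi2 t0).
  move=> [[[? ?] ?] ?]; have [Dn|Dp|/eqP] := ltrgtP D 0; last by rewrite (negbTE D0).
    have : atan (t0 + t1) < atan t0.
      by apply: lt_atan; rewrite gtrDl ltr_ndivrMr // mul0r.
    by rewrite ltr0_sg // mulN1r => ?; apply/andP; split; lra.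
  have : atan t0 < atan (t0 + t1) by apply: lt_atan; rewrite ltrDl divr_gt0.
  by rewrite gtr0_sg // mul1r => ?; apply/andP; split; lra.
Qed.

End Angles.

(** * The winding number as a signed count of line crossings *)

Section Winding.
Import numFieldNormedType.Exports.
Local Open Scope classical_set_scope.
Local Open Scope ring_scope.
Variable R : realType.

Lemma winding_number_unique (T : R) gamma w w' : 0 <= T ->
  is_winding_number T gamma w -> is_winding_number T gamma w' -> w = w'.
Proof.
move=> T0 [f [fc fa fT]] [g [gc ga gT]].
have pi0 := pi_gt0 R.
have fg s : s \in `[0, T] -> cos (f s - g s) = 1.
  move=> sT; have [k ->] := is_argument_eq _ _ _ _ (fa s sT) (ga s sT).
  have -> : 2 * pi * k%:~R = 0 + pi * (k * 2)%:~R :> R by rewrite rmorphM /=; ring.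
  by rewrite cosDpi_int abszM exprM sqrr_sign mul1r cos0.
have hc : {within `[0, T], continuous (f - g)} by apply: within_continuousB.
have hT : (f T - g T) - (f 0 - g 0) = 2 * pi * (w - w')%:~R.
  by rewrite rmorphB /= mulrBr -fT -gT; ring.
(* If w <> w', the intermediate value theorem makes f - g take a value at
   distance pi from its initial value, contradicting cos (f - g) = 1. *)
have nopi : forall e : R, e = pi \/ e = - pi ->
    ~ (Num.min (f 0 - g 0) (f T - g T) <= f 0 - g 0 + e <= Num.max (f 0 - g 0) (f T - g T)).
  move=> e epi /(IVT T0 hc)[c cT]; rewrite -[(f - g) c]/(f c - g c) => E.
  have := fg c cT; rewrite E cosD; have -> : sin e = 0.
    by case: epi => ->; rewrite ?sinN sinpi ?oppr0.
  have -> : cos e = -1 by case: epi => ->; rewrite ?cosN cospi.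
  rewrite fg ?in_itv /= ?lexx //; lra.
have [ww|ww|//] := ltrgtP w w'; exfalso.
  apply: (nopi (- pi)); first by right.
  have : (w - w')%:~R <= -1 :> R by rewrite (ler_int _ _ (-1)); lia.
  rewrite -(ler_pM2l pi0) => H; rewrite ge_min le_max.
  by apply/andP; split; apply/orP; [right|left]; lra.
apply: (nopi pi); first by left.
have : 1 <= (w - w')%:~R :> R by rewrite (ler_int _ 1); lia.
rewrite -(ler_pM2l pi0) => H; rewrite ge_min le_max.
by apply/andP; split; apply/orP; [left|right]; lra.
Qed.

Variable P : seq 'rV[int]_2.
Hypothesis det_neq0 : forall i, det2 (pt P i) (pt P i.+1) != 0.

(** At the right endpoint [truncn] already selects the next edge, but that edge starts where this
    one ends. *)
Lemma polygonal_curve_edge (i : nat) (s : R) : i%:R <= s <= i.+1%:R ->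
  @polygonal_curve R P s =
    (1 - (s - i%:R)) *: toR R (pt P i) + (s - i%:R) *: toR R (pt P i.+1).
Proof.
move=> /andP[le_is]; rewrite le_eqVlt => /orP[/eqP ->|si].
  have E : Num.truncn (i.+1%:R : R) = i.+1 by apply: truncn_def; rewrite lexx ltr_nat ltnSn.
  rewrite /polygonal_curve E subrr subr0 scale1r scale0r addr0.
  by rewrite -natr1 [_ + 1]addrC addrK subrr scale0r scale1r add0r.
have E : Num.truncn s = i by apply: truncn_def; rewrite le_is.
by rewrite /polygonal_curve E.
Qed.

Variable N : int.
Let p i := pt P i 0 0 + N * pt P i 0 1.
Hypothesis p_neq0 : forall i, p i != 0.

(* atan N is the direction in which the linear form p is maximal. *)
Lemma sg_cos_argument i (x : R) : is_argument R (toR R (pt P i)) x ->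
  Num.sg (cos (x - atan N%:~R)) = (Num.sg (p i))%:~R.
Proof.
move=> /is_argumentP[r [r0]]; rewrite !mxE => v0 v1.
have c0 : 0 < cos (atan N%:~R) :> R.
  by apply: cos_gt0_pihalf; rewrite atan_gtNpi2 atan_ltpi2.
have sE : sin (atan N%:~R) = N%:~R * cos (atan N%:~R) :> R.
  by rewrite -[X in X * _]atanK /tan divfK // gt_eqF.
have E : r * cos (x - atan N%:~R) = cos (atan N%:~R) * (p i)%:~R.
  by rewrite cosB sE rmorphD rmorphM /= v0 v1; ring.
have : Num.sg (r * cos (x - atan N%:~R)) = Num.sg (p i)%:~R :> R.
  by rewrite E sgrM (gtr0_sg c0) mul1r.
by rewrite sgrM (gtr0_sg r0) mul1r => ->; rewrite intr_sg.
Qed.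

(** By induction on the edges, the angle functions of [edge_argument] are glued at integer times; an
    edge shifts the half-turn index by its orientation sign if it crosses the line [p = 0], and by 0
    otherwise. *)
Lemma curve_argument m : exists (theta : R -> R) (k0 k : int),
  [/\ {within `[0, m%:R], continuous theta},
      (forall s, s \in `[0, m%:R] -> is_argument R (@polygonal_curve R P s) (theta s)),
      half_turn R (theta 0 - atan N%:~R) k0,
      half_turn R (theta m%:R - atan N%:~R) k
    & 2 * (k - k0) = \sum_(i < m) Num.sg (det2 (pt P i) (pt P i.+1)) *
                       (1 - Num.sg (p i) * Num.sg (p i.+1))].
Proof.
have curve_nat i : @polygonal_curve R P i%:R = toR R (pt P i).
  rewrite (@polygonal_curve_edge i) ?lexx ?ler_nat ?leqnSn //.
  by rewrite subrr subr0 scale1r scale0r addr0.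
have cosP i x : is_argument R (toR R (pt P i)) x -> cos (x - atan N%:~R) != 0.
  by move=> /sg_cos_argument H; rewrite -sgr_eq0 H intr_eq0 sgr_eq0.
elim: m => [|m [theta [k0 [k [thetac thetaP h0 hm hk]]]]].
  have [x xP] : exists x, is_argument R (toR R (pt P 0%N)) x.
    apply: is_argument_ex; rewrite !mxE !intr_eq0; apply/orP; rewrite -negb_and.
    apply: contra (det_neq0 0) => /andP[/eqP x0 /eqP x1].
    by rewrite det2E x0 x1 !mul0r subrr.
  have [k kP] := half_turn_ex _ _ (cosP _ _ xP).
  exists (fun=> x), k, k; split => //.
  - exact/continuous_subspaceT/cst_continuous.
  - move=> s; rewrite in_itv /= -eq_le => /eqP <-.
    by rewrite -[0]/(0%:R) curve_nat.
  - by rewrite big_ord0 subrr mulr0.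
set D := det2 (pt P m) (pt P m.+1).
have DE : (D%:~R : R) = toR R (pt P m) 0 0 * toR R (pt P m.+1) 0 1
                      - toR R (pt P m) 0 1 * toR R (pt P m.+1) 0 0.
  by rewrite /D det2E rmorphB !rmorphM /= !mxE.
have am : is_argument R (toR R (pt P m)) (theta m%:R).
  by rewrite -curve_nat; apply: thetaP; rewrite in_itv /= ler0n lexx.
have [|phi [phic phi0 phiP phi1]] :=
    edge_argument R (toR R (pt P m)) (toR R (pt P m.+1)) (theta m%:R) _ am.
  by rewrite -DE intr_eq0 det_neq0.
rewrite -DE in phi1.
(* The pieces agree at [m] because [phi 0 = theta m]. *)
pose th s := if s <= m%:R then theta s else phi (s - m%:R).
have thL s : s <= m%:R -> th s = theta s by rewrite /th => ->.
have thR s : m%:R <= s -> th s = phi (s - m%:R).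
  rewrite /th le_eqVlt => /orP[/eqP <-|]; first by rewrite lexx subrr phi0.
  by rewrite ltNge => /negbTE ->.
have th1 : th m.+1%:R = phi 1.
  by rewrite thR ?ler_nat ?leqnSn // -natr1 [_ + 1]addrC addrK.
have am1 : is_argument R (toR R (pt P m.+1)) (phi 1).
  by have := phiP 1; rewrite subrr scale0r scale1r add0r.
have [k' k'P] := half_turn_ex _ _ (cosP _ _ am1).
exists th, k0, k'; split => //.
- have -> : `[0, m.+1%:R]%classic = `[0, m%:R]%classic `|` `[m%:R, m.+1%:R]%classic :> set R.
    apply/seteqP; split => s /=; rewrite !in_itv /=.
      move=> /andP[s0 s1]; rewrite s0 s1 andbT /=.
      by apply/orP; rewrite le_total.
    have m1 : m%:R <= m.+1%:R :> R by rewrite ler_nat leqnSn.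
    have m0 : 0 <= m%:R :> R by rewrite ler0n.
    by case=> /andP[? ?]; apply/andP; split; lra.
  apply: withinU_continuous; [exact: itv_closed|exact: itv_closed| |].
    apply: (subspace_eq_continuous _ thetac) => s /set_mem /=.
    by rewrite in_itv /= => /andP[_ sm]; exact/esym/thL.
  have shiftc : {within `[m%:R, m.+1%:R], continuous (fun s : R => phi (s - m%:R))}.
    apply: continuous_subspaceT => s.
    apply: (@continuous_comp _ _ _ (fun s : R => s - m%:R) phi); last exact: phic.
    by apply: cvgB; [exact: cvg_id|exact: cvg_cst].
  apply: (subspace_eq_continuous _ shiftc) => s /set_mem /=.
  by rewrite in_itv /= => /andP[ms _]; exact/esym/thR.
- move=> s; rewrite in_itv /= => /andP[s0 s1]; have [sm|ms] := leP s m%:R.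
    by rewrite thL //; apply: thetaP; rewrite in_itv /= s0.
  by rewrite thR ?(ltW ms) // (@polygonal_curve_edge m) // (ltW ms).
- by rewrite thL // ler0n.
- by rewrite th1.
rewrite big_ord_recr /= -hk -/D.
have -> : 2 * (k' - k0) = 2 * (k - k0) + 2 * (k' - k) by ring.
congr (_ + _); apply/eqP; rewrite -(eqr_int R) !rmorphM !rmorphB rmorphM /=.
have D0 : D != 0 := det_neq0 m.
rewrite -(sg_cos_argument _ _ am) -(sg_cos_argument _ _ am1) intr_sg.
rewrite -rmorphB; apply/eqP; apply: half_turn_step_sg hm k'P _ _.
  by rewrite !inE -intr_sg; case: sgrP D0 => // _; rewrite ?rmorphN /= eqxx ?orbT.
by have := phi1; rewrite opprB addrA subrK.
Qed.

(** The curve closes up, so the angle changes by [2 * pi * w]. Both end angles are within pi / 2 of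
    their half-turn positions, so the integer [2 * w - (k - k0)] has absolute value below 1. *)
Lemma winding_numberE : (0 < size P)%N ->
  4 * winding_number R P = \sum_(i < size P) Num.sg (det2 (pt P i) (pt P i.+1)) *
                       (1 - Num.sg (p i) * Num.sg (p i.+1)).
Proof.
move=> P0; have [theta [k0 [k [thetac thetaP h0 hk <-]]]] := curve_argument (size P).
have T0 : 0 <= (size P)%:R :> R by rewrite ler0n.
have pi0 := pi_gt0 R.
have [w wE] : exists w, theta (size P)%:R - theta 0 = 2 * pi * w%:~R.
  apply: (is_argument_eq R (toR R (pt P 0%N))).
    have <- : @polygonal_curve R P (size P)%:R = toR R (pt P 0%N).
      rewrite (@polygonal_curve_edge (size P)) ?lexx ?ler_nat ?leqnSn //.
      rewrite subrr subr0 scale1r scale0r addr0; congr (toR R _).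
      by rewrite /pt modnn mod0n.
    by apply: thetaP; rewrite in_itv /= T0 lexx.
  have <- : @polygonal_curve R P 0 = toR R (pt P 0%N).
    rewrite (@polygonal_curve_edge 0) ?lexx ?ler01 //.
    by rewrite subrr subr0 scale1r scale0r addr0.
  by apply: thetaP; rewrite in_itv /= T0 lexx.
have wP : is_winding_number (size P)%:R (@polygonal_curve R P) w by exists theta.
have -> : winding_number R P = w.
  apply: (winding_number_unique _ _ _ _ T0 _ wP).
  by rewrite /winding_number; apply: xgetPex; exists w.
have : (2 * w - (k - k0))%:~R < 1 :> R.
  rewrite -(ltr_pM2l pi0) !rmorphB rmorphM /=.
  by move: hk h0; rewrite /half_turn !ltr_norml => /andP[? ?] /andP[? ?]; lra.
have : -1 < (2 * w - (k - k0))%:~R :> R.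
  rewrite -(ltr_pM2l pi0) !rmorphB rmorphM /=.
  by move: hk h0; rewrite /half_turn !ltr_norml => /andP[? ?] /andP[? ?]; lra.
rewrite (ltr_int _ (-1)) (ltr_int _ _ 1); lia.
Qed.

End Winding.

(** * A linear form in general position, and the final count *)

Lemma generic_linear_form (P : seq 'rV[int]_2) : (0 < size P)%N ->
  (forall i, pt P i != 0) ->
  exists N : int, forall i, pt P i 0 0 + N * pt P i 0 1 != 0.
Proof.
(* This exceeds every first coordinate in absolute value, so a nonzero second coordinate cannot be
   cancelled. *)
move=> P0 x0; exists (1 + \sum_(i < size P) `|pt P i 0 0|) => i.
have -> : pt P i = pt P (i %% size P)%N by rewrite /pt modn_mod.
have im : (i %% size P < size P)%N by rewrite ltn_pmod.
have le_sum : `|pt P (i %% size P)%N 0 0| <= \sum_(i < size P) `|pt P i 0 0|.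
  by rewrite (bigD1 (Ordinal im)) //= lerDl sumr_ge0.
have := x0 (i %% size P)%N; move: le_sum.
move: (pt P (i %% size P)%N) (\sum_(i < _) _) => x S le_sum xn0.
have [x1|x1] := eqVneq (x 0 1) 0.
  apply: contra xn0; rewrite x1 mulr0 addr0 => /eqP x00.
  by apply/eqP/rV2P; rewrite ?x00 ?x1 mxE.
by move: le_sum x1; move: (x 0 0) (x 0 1) => a b; nia.
Qed.

Theorem corollary2p7 (R : realType) (l : nat) (P : seq 'rV[int]_2)
    (hl : (0 < l)%N) (hP : reflexive_loop R l P) :
  loop_length l P + loop_length l (dual_loop R l P)
    = 12%:R * (winding_number R P)%:~R :> rat.
Proof.
have [P0 H] := hP; pose x := pt P.
have lz : l%:Z != 0 by lia.
pose e i := Num.sg (det2 (x i) (x i.+1)).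
have D i : det2 (x i) (x i.+1) = e i * l%:Z.
  rewrite /e /x; have [_ _ + _] := H i; case=> ->.
    by rewrite gtr0_sg ?mul1r; lia.
  by rewrite ltr0_sg ?mulN1r; lia.
have e1 i : e i = 1 \/ e i = -1.
  by rewrite /e /x; have [_ _ + _] := H i; case=> ->; [left; rewrite gtr0_sg|right; rewrite ltr0_sg]; lia.
have ee i := sqr_unit_int _ (e1 i).
have [|N p0] := @generic_linear_form P P0; first by move=> i; case: (H i).
have [b bE] := choice (fun i => loop_recurrence R l P i (e i) (e i.+1) hl hP
  (e1 i) (e1 i.+1) (D i) (D i.+1)).
pose p i := x i 0 0 + N * x i 0 1.
have sum_b : \sum_(i < size P) b i =
    3 * \sum_(i < size P) e i * Num.sg (p i) * Num.sg (p i.+1).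
  (* Replacing the first coordinate by [p] is a shear, so [p] and the second coordinate still have
     determinant [e i * l]. *)
  apply: (@sum_curvature _ l%:Z p (fun i => x i 0 1)) => //.
  - by move=> i; rewrite /p /x pt_period.
  - by move=> i; rewrite /x pt_period.
  - by move=> i; rewrite /e /x -addSn !pt_period.
  - by move=> i; rewrite -D det2E /p; ring.
  - move=> i; have /rowP E := bE i; rewrite /p; move: (E 0) (E 1).
    rewrite !mxE -/(x i) -/(x i.+1) -/(x i.+2) => E0 E1.
    transitivity ((e i * x i 0 0 + e i.+1 * x i.+2 0 0)
      + N * (e i * x i 0 1 + e i.+1 * x i.+2 0 1)); first by ring.
    by rewrite E0 E1; ring.
pose u i := outer_normal R l (x i) (x i.+1).
have uP i : is_outer_normal R l (x i) (x i.+1) (u i).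
  by have [_ ? ? _] := H i; apply: outer_normalP.
have duE i : det2 (u i) (u i.+1) = (e i + e i.+1 - b i) * l%:Z.
  have [[_ ux uy] [_ vy vz]] := (uP i, uP i.+1).
  rewrite (det2_outer_normals _ _ _ _ _ _ _ _ (ee i) (ee i.+1) (D i) (D i.+1) lz ux uy vy vz).
  (* The determinant of [x i] with both sides of the recurrence [bE i]. *)
  have bD : e i.+1 * det2 (x i) (x i.+2) = b i * det2 (x i) (x i.+1).
    have /rowP E := bE i; move: (E 0) (E 1).
    rewrite !mxE !det2E -/(x i) -/(x i.+1) -/(x i.+2) => E0 E1.
    transitivity (x i 0 0 * (e i * x i 0 1 + e i.+1 * x i.+2 0 1)
      - x i 0 1 * (e i * x i 0 0 + e i.+1 * x i.+2 0 0)); first by ring.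
    by rewrite E0 E1; ring.
  have -> : e i * e i.+1 * det2 (x i) (x i.+2) = e i * e i * b i * l%:Z.
    by rewrite -mulrA bD D; ring.
  by rewrite ee; ring.
have lq : (l%:R : rat) != 0 by rewrite pnatr_eq0 -lt0n.
have winding : 4 * winding_number R P =
    \sum_(i < size P) e i * (1 - Num.sg (p i) * Num.sg (p i.+1)).
  by apply: winding_numberE => // i; rewrite D mulf_neq0 //; case: (e1 i) => ->.
have shift_e : \sum_(i < size P) e i.+1 = \sum_(i < size P) e i.
  by apply: sum_cyclic_shift; rewrite /e /x -[size P]add0n -addSn !pt_period.
rewrite dual_loop_lengthE // /loop_length -mulr_suml -rmorph_sum /=.
rewrite -mulrDl -rmorphD /=; apply: (mulIf lq); rewrite divfK //.
have -> : \sum_(i < size P) det2 (pt P i) (pt P i.+1)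
    = \sum_(i < size P) e i * l%:Z by apply: eq_bigr => i _; exact: D.
rewrite (eq_bigr _ (fun (i : 'I_(size P)) _ => duE i)).
rewrite -!mulr_suml sumrB big_split /= shift_e sum_b -mulrDl rmorphM /= -pmulrn.
(* The sum of [3 * e i - b i] is, by [sum_b], 3 times the crossing sum, which equals
   [4 * winding_number R P]. *)
congr (_ * _); have -> : 12 * (winding_number R P)%:~R = (3 * (4 * winding_number R P))%:~R :> rat.
  by rewrite !rmorphM /= mulrA -natrM.
congr (_%:~R); rewrite winding.
under [in RHS]eq_bigr do rewrite mulrBr mulr1 mulrA.
by rewrite sumrB; ring.
Qed.
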